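(* Any vacuum can be deformed by an isometric transformation and a coordinate change (if necessary) to the potential of the Clifford torus. That is, let $\eta=\lambda^{-1}A\,dz$ with $0\neq A\in\mathcal{G}_{-1}$ a constant matrix satisfying $[A,\tau(A)]=0$. Then there exist a matrix $k=\mathrm{diag}(e^{i\delta},e^{-i\delta},1)$ with $\delta\in\mathbb{R}$ and a holomorphic change of coordinate $z\mapsto w$ such that $$k\,\eta\,k^{-1}=\lambda^{-1}\begin{pmatrix}0&0&i\\ i&0&0\\ 0&i&0\end{pmatrix}dw .$$
   Context: $\mathcal{G}_{-1}$ is the set of complex matrices of the form $\begin{pmatrix}0&0&a\\ b&0&0\\ 0&a&0\end{pmatrix}$, $a,b\in\mathbb{C}$, and $\tau(X)=-\overline{X}^{t}$ is the conjugation of $\mathfrak{sl}(3,\mathbb{C})$ with respect to $\mathfrak{su}(3)$. A vacuum is an extended framing (of a minimal Lagrangian surface in $\mathbb{C}P^2$) whose normalized potential is $\eta=\lambda^{-1}A\,dz$ with $A\in\mathcal{G}_{-1}$ constant and $[A,\tau(A)]=0$. The potential of the Clifford torus is $\lambda^{-1}\begin{pmatrix}0&0&i\\ i&0&0\\ 0&i&0\end{pmatrix}dz$. The isometric transformation acts on potentials by conjugation with a constant diagonal matrix $\mathrm{diag}(e^{i\delta},e^{-i\delta},1)$, $\delta\in\mathbb{R}$. *)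

(* Defs.v *)
From HB Require Import structures.
From mathcomp Require Import all_boot all_order all_algebra.
From mathcomp Require Import complex.
From mathcomp Require Import all_classical all_reals all_analysis.

Set Implicit Arguments.
Unset Strict Implicit.
Unset Printing Implicit Defensive.

Import Order.TTheory GRing.Theory Num.Theory.
Import numFieldNormedType.Exports.

Local Open Scope classical_set_scope.
Local Open Scope ring_scope.

Definition expi (R : realType) (t : R) : R[i] := (cos t +i* sin t)%C.

Definition Gm1_mx (R : realType) (a b : R[i]) : 'M[R[i]]_3 :=
  \matrix_(i < 3, j < 3)
    nth 0 (nth [::] [:: [:: 0; 0; a];
                        [:: b; 0; 0];
                        [:: 0; a; 0]] i) j.

Definition Gm1 (R : realType) : set 'M[R[i]]_3 :=
  [set X | exists a b : R[i], X = Gm1_mx a b].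

Definition tau (R : realType) (X : 'M[R[i]]_3) : 'M[R[i]]_3 :=
  - (map_mx Num.conj X)^T.

Definition lie (R : realType) (X Y : 'M[R[i]]_3) : 'M[R[i]]_3 :=
  X *m Y - Y *m X.

Definition clifford_mx (R : realType) : 'M[R[i]]_3 := Gm1_mx 'i%C 'i%C.

Definition isometric_mx (R : realType) (delta : R) : 'M[R[i]]_3 :=
  diag_mx (\row_(j < 3) nth 0 [:: expi delta; expi (- delta); 1] j).

(* A potential is a family, indexed by the spectral parameter lambda, of
   matrix-valued 1-forms: [eta lambda p v] is the value at the point [p] on the
   tangent vector [v]. *)
Definition potential (R : realType) :=
  R[i] -> R[i]^o -> R[i]^o -> 'M[R[i]]_3.

(* lambda^-1 A dw, where dw is the complex differential of w; the coordinate
   form dz is the case w = id. *)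
Definition const_potential (R : realType) (A : 'M[R[i]]_3)
    (w : R[i]^o -> R[i]^o) : potential R :=
  fun lambda p v => (lambda^-1 * ('d w p v : R[i]^o)) *: A.

Definition conj_potential (R : realType) (k : 'M[R[i]]_3)
    (eta : potential R) : potential R :=
  fun lambda p v => k *m eta lambda p v *m invmx k.

(* The parameter lambda ranges over C^*. *)
Definition eq_potential_on (R : realType) (D : set R[i]^o)
    (eta eta' : potential R) : Prop :=
  forall lambda : R[i], lambda != 0 ->
  forall p : R[i]^o, D p -> forall v : R[i]^o, eta lambda p v = eta' lambda p v.

(* R[i]^o is a normed space over the field R[i] itself, so differentiability
   here is complex differentiability. *)
Definition holomorphic_on (R : realType) (D : set R[i]^o)
    (f : R[i]^o -> R[i]^o) : Prop :=
  forall p : R[i]^o, D p -> differentiable f p.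

(* w is biholomorphic from D onto the open set w(D). *)
Definition coordinate_change (R : realType) (D : set R[i]^o)
    (w : R[i]^o -> R[i]^o) : Prop :=
  [/\ holomorphic_on D w, open (w @` D) &
      exists2 g : R[i]^o -> R[i]^o, holomorphic_on (w @` D) g &
        forall p : R[i]^o, D p -> g (w p) = p].

(* Main.v *)
(** The diagonal of [A, tau A] = 0 gives |a| = |b|, so b / a = e^(3 i delta) for
    some real delta. Conjugation by diag(e^(i delta), e^(-i delta), 1) sends
    (a, b) to (e^(i delta) a, e^(-2 i delta) b), whose two entries then agree;
    their common value is absorbed by the linear coordinate w = -i e^(i delta) a z. *)

Require Import Defs.
From mathcomp Require Import all_boot all_order all_algebra.
From mathcomp Require Import complex.
From mathcomp Require Import all_classical all_reals all_analysis.
Import numFieldNormedType.Exports.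
Local Open Scope classical_set_scope.
Local Open Scope ring_scope.
Import Order.TTheory GRing.Theory Num.Theory.

Lemma expiD (R : realType) (s t : R) : expi (s + t) = expi s * expi t.
Proof.
by apply/eqP; rewrite eq_complex /= cosD sinD addrC [in X in _ && X]addrC !eqxx.
Qed.

Lemma expi0 (R : realType) : expi (0 : R) = 1.
Proof. by rewrite /expi cos0 sin0. Qed.

Lemma expi_neq0 (R : realType) (t : R) : expi t != 0.
Proof.
apply/eqP => t0; have := expiD R t (- t).
by rewrite subrr expi0 t0 mul0r => /eqP; rewrite oner_eq0.
Qed.

(** The angle is [acos x] or its opposite, according to the sign of [y]: [sin (acos x)] is the
    nonnegative root of [1 - x ^+ 2], that is [|y|]. *)
Lemma expi_surj (R : realType) (z : R[i]) : `|z| = 1 -> exists t, z = expi t.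
Proof.
case: z => x y z1.
have xy1 : x ^+ 2 + y ^+ 2 = 1.
  move/(congr1 (fun u => u ^+ 2)) : z1.
  by rewrite -add_Re2_Im2 /= expr1n => -[].
have x1 : -1 <= x <= 1.
  rewrite -ler_norml -(@ler_pXn2r _ 2) ?nnegrE// expr1n real_normK ?num_real//.
  by rewrite -xy1 lerDl sqr_ge0.
have sx : Num.sqrt (1 - x ^+ 2) = `|y|.
  by rewrite -xy1 addrAC subrr add0r sqrtr_sqr.
have [y0|y0] := leP 0 y.
  by exists (acos x); rewrite /expi acosK ?in_itv// sin_acos// sx ger0_norm.
exists (- acos x).
by rewrite /expi cosN sinN acosK ?in_itv// sin_acos// sx ltr0_norm// opprK.
Qed.

(** The (0, 0) entry of the bracket is |b|^2 - |a|^2. *)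
Lemma Gm1_mx_vacuum_norm (R : realType) (a b : R[i]) :
  lie (Gm1_mx a b) (tau (Gm1_mx a b)) = 0 -> `|a| = `|b|.
Proof.
move=> /matrixP/(_ 0 0); rewrite !mxE !big_ord_recl !big_ord0 !mxE /=.
rewrite !mul0r !mulr0 !add0r !addr0 mulrN mulNr opprK [_ * b]mulrC -!normCK.
by rewrite addrC => /subr0_eq/eqP; rewrite eqrXn2// => /eqP.
Qed.

Lemma Gm1_mxZ (R : realType) (c a b : R[i]) :
  c *: Gm1_mx a b = Gm1_mx (c * a) (c * b).
Proof.
by apply/matrixP => -[[|[|[|//]]] ?] [[|[|[|//]]] ?]; rewrite !mxE /= ?mulr0.
Qed.

Lemma isometric_mxV (R : realType) (delta : R) :
  invmx (isometric_mx delta) = isometric_mx (- delta).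
Proof.
have kk : isometric_mx (- delta) *m isometric_mx delta = 1%:M.
  rewrite mulmx_diag -diag_const_mx; congr diag_mx; apply/rowP.
  by move=> -[[|[|[|//]]] ?]; rewrite !mxE /= ?mulr1// -expiD ?addNr ?subrr expi0.
have [_ ku] := mulmx1_unit kk.
by rewrite -[LHS]mul1mx -kk mulmxK.
Qed.

(** Entry (0, 2) gets e^(i delta) from the left factor and entry (2, 1) gets it from the right one,
    so the shape of [Gm1_mx] survives; entry (1, 0) gets e^(-i delta) from both sides. *)
Lemma isometric_mx_conj (R : realType) (delta : R) (a b : R[i]) :
  isometric_mx delta *m Gm1_mx a b *m invmx (isometric_mx delta) =
  Gm1_mx (expi delta * a) (expi (- (delta *+ 2)) * b).
Proof.
rewrite isometric_mxV mul_mx_diag mul_diag_mx.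
apply/matrixP => -[[|[|[|//]]] ?] [[|[|[|//]]] ?];
  rewrite !mxE /= ?mulr0 ?mul0r ?mulr1 ?mul1r//; last by rewrite opprK mulrC.
by rewrite mulrAC -expiD mulr2n opprD.
Qed.

Lemma coordinate_change_scale (R : realType) (D : set R[i]^o) (c : R[i]) :
  open D -> c != 0 -> coordinate_change D ( *:%R c).
Proof.
move=> openD c0; split; first by move=> p _; exact: ex_diff.
(* As a preimage under the continuous inverse scaling, the image is open. *)
- have -> : *:%R c @` D = *:%R c^-1 @^-1` D.
    apply/seteqP; split=> [_ [p Dp <-]|p /= Dp].
      by rewrite /= scalerA mulVf// scale1r.
    by exists (c^-1 *: p); rewrite ?scalerA ?mulfV ?scale1r.
  by apply: open_comp => // p _; exact: scaler_continuous.
- exists ( *:%R c^-1); first by move=> p _; exact: ex_diff.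
  by move=> p _; rewrite scalerA mulVf// scale1r.
Qed.

Lemma const_potential_scale (R : realType) (A : 'M[R[i]]_3) (c : R[i])
    (lambda : R[i]) (p v : R[i]^o) :
  const_potential A ( *:%R c) lambda p v = (lambda^-1 * (c * v)) *: A.
Proof.
(* A linear map is its own differential; [c *: v] then becomes [c * v] by conversion. *)
have dw : 'd ( *:%R c : R[i]^o -> R[i]^o) p v = c *: v by rewrite diff_val.
exact: (congr1 (fun u : R[i] => (lambda^-1 * u) *: A) dw).
Qed.

Lemma const_potential_id (R : realType) (A : 'M[R[i]]_3) (lambda : R[i])
    (p v : R[i]^o) :
  const_potential A id lambda p v = (lambda^-1 * v) *: A.
Proof.
have dz : 'd (id : R[i]^o -> R[i]^o) p v = v by rewrite diff_val.
exact: (congr1 (fun u : R[i] => (lambda^-1 * u) *: A) dz).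
Qed.

Theorem proposition3p1 (R : realType) (D : set R[i]^o) (openD : open D)
    (A : 'M[R[i]]_3) (A_neq0 : A != 0) (A_Gm1 : Gm1 A)
    (A_vacuum : lie A (tau A) = 0) :
  exists (delta : R) (w : R[i]^o -> R[i]^o),
    coordinate_change D w /\
    eq_potential_on D
      (conj_potential (isometric_mx delta) (const_potential A id))
      (const_potential (clifford_mx R) w).
Proof.
have [a [b defA]] := A_Gm1; rewrite {A A_Gm1}defA in A_neq0 A_vacuum *.
have ab := Gm1_mx_vacuum_norm _ _ _ A_vacuum.
(* If [a] vanished, so would [b] by equality of norms, and with them the whole matrix. *)
have a0 : a != 0.
  apply: contraNneq A_neq0 => a0; move: ab; rewrite a0 normr0.
  move/esym/eqP; rewrite normr_eq0 => /eqP ->.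
  by rewrite -[X in Gm1_mx X X](mul0r 0) -Gm1_mxZ scale0r.
have [t bat] : exists t, b / a = expi t.
  by apply: expi_surj; rewrite normrM normfV -ab mulfV// normr_eq0.
(* Solves [- 2 delta + t = delta], the equality of arguments of the two conjugated entries. *)
pose delta := t / 3.
have entries_eq : expi (- (delta *+ 2)) * b = expi delta * a.
  rewrite -[b](divfK a0) bat mulrA -expiD; congr (expi _ * _).
  have -> : t = delta *+ 3 by rewrite -mulr_natr divfK.
  by rewrite [delta *+ 3]mulrS addrCA addNr addr0.
have i0 : 'i%C != 0 :> R[i] by rewrite eq_complex /= oner_eq0 andbF.
(* Chosen so that [c * 'i] is the common entry. *)
pose c := expi delta * a / 'i%C.
have c0 : c != 0 by rewrite !mulf_neq0 ?invr_eq0 ?expi_neq0.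
exists delta, ( *:%R c); split; first exact: coordinate_change_scale.
move=> lambda _ p _ v.
rewrite /conj_potential const_potential_id const_potential_scale.
rewrite -scalemxAr -scalemxAl isometric_mx_conj entries_eq.
(* The factor [c] moves from the differential of [w] onto the Clifford matrix. *)
rewrite [c * v]mulrC mulrA -scalerA; congr (_ *: _).
by rewrite Gm1_mxZ /c divfK.
Qed.
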